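(* Let $0<\alpha<1$ and $p,q>0$. If $\mathrm{Tr}\,\widetilde{SG}_{\alpha,p}(A,B)\le\mathrm{Tr}\,\mathcal{A}_{\alpha,q}(A,B)$ holds for all positive definite $2\times2$ matrices $A,B$, then $\min\{1,(1-\alpha)p\}\le q$.
   Context: For positive definite $A,B$: $A\#_\alpha B:=A^{1/2}(A^{-1/2}BA^{-1/2})^\alpha A^{1/2}$; $\widetilde F_\alpha(A,B):=(A^{-1}\#_\alpha B)^{1/2}A^{2(1-\alpha)}(A^{-1}\#_\alpha B)^{1/2}$; $\widetilde{SG}_{\alpha,p}(A,B):=\widetilde F_\alpha(A^p,B^p)^{1/p}$; $\mathcal{A}_{\alpha,q}(A,B):=((1-\alpha)A^q+\alpha B^q)^{1/q}$. $\mathrm{Tr}$ is the usual trace. *)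

(* Defs.v *)
From HB Require Import structures.
From mathcomp Require Import all_boot all_order all_algebra.
From mathcomp Require Import spectral.
From mathcomp Require Import complex.
From mathcomp Require Import reals exp.
Set Implicit Arguments.
Unset Strict Implicit.
Unset Printing Implicit Defensive.
Import Order.TTheory GRing.Theory Num.Theory.
Local Open Scope ring_scope.

Section Defs.
Variable R : realType.
Local Notation C := R[i].

Definition adj {m n} (A : 'M[C]_(m, n)) : 'M[C]_(n, m) := (map_mx Num.conj A)^T.

Definition posdef {n} (A : 'M[C]_n) : Prop :=
  adj A = A /\ forall v : 'rV[C]_n, v != 0 -> 0 < (v *m A *m adj v) 0 0.

(* real power A^t of a positive definite matrix via its spectral
   decomposition A = U^-1 diag(lambda) U (U unitary): A^t = U^-1 diag(lambda^t) U *)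
Definition mxpow {n} (A : 'M[C]_n) (t : R) : 'M[C]_n :=
  invmx (spectralmx A) *m
  diag_mx (\row_i ((powR (complex.Re (spectral_diag A 0 i)) t)%:C)%C) *m
  spectralmx A.

Definition gmean {n} (alpha : R) (A B : 'M[C]_n) : 'M[C]_n :=
  mxpow A (2^-1) *m
  mxpow (mxpow A (- 2^-1) *m B *m mxpow A (- 2^-1)) alpha *m
  mxpow A (2^-1).

Definition Ftilde {n} (alpha : R) (A B : 'M[C]_n) : 'M[C]_n :=
  let G := gmean alpha (invmx A) B in
  mxpow G (2^-1) *m mxpow A (2 * (1 - alpha)) *m mxpow G (2^-1).

Definition SGtilde {n} (alpha p : R) (A B : 'M[C]_n) : 'M[C]_n :=
  mxpow (Ftilde alpha (mxpow A p) (mxpow B p)) p^-1.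

Definition Amean {n} (alpha q : R) (A B : 'M[C]_n) : 'M[C]_n :=
  mxpow (((1 - alpha)%:C)%C *: mxpow A q + (alpha%:C)%C *: mxpow B q) q^-1.

End Defs.

(* Main.v *)
Require Import Defs.
From HB Require Import structures.
From mathcomp Require Import all_boot all_order all_algebra.
From mathcomp Require Import spectral complex.
From mathcomp Require Import reals sequences exp.
From mathcomp Require Import ring lra.
Set Implicit Arguments.
Unset Strict Implicit.
Unset Printing Implicit Defensive.
Import Order.TTheory GRing.Theory Num.Theory.
Local Open Scope ring_scope.

(* Test the inequality on [A = diag(1, b)] and its rotation [B] by an angle
   [theta], with [b -> 0] and then [theta -> 0]. If [q < 1], then
   [Tr A_q = 1 - alpha (1 - alpha) theta^2 / q + o(theta^2)], whereas
   [Tr SG >= (cos theta)^(2 alpha / p) + o(1)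
          = 1 - alpha theta^2 / p + o(theta^2)],
   so [alpha / p >= alpha (1 - alpha) / q].
   The lower bound is explicit: with [X = A^p], [Y = B^p] and
   [G = X^-1 #_alpha Y], the vector [e_1 G^(1/2)] shows that the top eigenvalue
   of [G^(1/2) X^(2(1-alpha)) G^(1/2)] is at least
   [G_11 = ((X^(1/2) Y X^(1/2))^alpha)_11], and [M^alpha >= tau^(alpha-1) M]
   for [0 <= M <= tau]. *)

(** * Adjoints and unitary matrices *)

Section Adjoint.
Variable R : realType.
Local Notation C := R[i].

Lemma adjM m n k (A : 'M[C]_(m, n)) (B : 'M[C]_(n, k)) :
  adj (A *m B) = adj B *m adj A.
Proof. by rewrite /adj map_mxM trmx_mul. Qed.

Lemma adjK m n (A : 'M[C]_(m, n)) : adj (adj A) = A.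
Proof. by apply/matrixP=> i j; rewrite !mxE conjCK. Qed.

Lemma adj_real_diag n (d : 'rV[R]_n) :
  adj (diag_mx (map_mx (real_complex R) d)) = diag_mx (map_mx (real_complex R) d).
Proof.
apply/matrixP=> i j; rewrite !mxE eq_sym; case: eqVneq => [->|_].
  by rewrite !mulr1n; apply: conjc_real.
by rewrite !mulr0n rmorph0.
Qed.

Lemma trmxC_adj m n (A : 'M[C]_(m, n)) : map_mx Num.conj A^T = adj A.
Proof. by rewrite /adj map_trmx. Qed.

Lemma unitary_adj n (U : 'M[C]_n) : U \is unitarymx -> invmx U = adj U.
Proof. by move/invmx_unitary ->; rewrite trmxC_adj. Qed.

Lemma unitary_adjV n (U : 'M[C]_n) : U \is unitarymx -> adj U *m U = 1%:M.
Proof. by move=> uU; rewrite -unitary_adj// mulVmx// unitarymx_unit. Qed.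

Lemma unitaryV_adj n (U : 'M[C]_n) : U \is unitarymx -> U *m adj U = 1%:M.
Proof. by move=> uU; rewrite -unitary_adj// mulmxV// unitarymx_unit. Qed.

Lemma qform_diag n (d : 'rV[C]_n) (U : 'M[C]_n) (v : 'rV[C]_n) :
  (v *m (adj U *m diag_mx d *m U) *m adj v) 0 0 =
  \sum_i d 0 i * `|(v *m adj U) 0 i| ^+ 2.
Proof.
have -> : v *m (adj U *m diag_mx d *m U) *m adj v =
          (v *m adj U) *m diag_mx d *m adj (v *m adj U).
  by rewrite adjM adjK !mulmxA.
rewrite mxE; apply: eq_bigr => i _.
by rewrite mul_mx_diag !mxE normCK mulrAC mulrC mulrA.
Qed.

Lemma qform_ge0 n (v : 'rV[C]_n) : 0 <= (v *m adj v) 0 0.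
Proof.
by rewrite mxE sumr_ge0// => i _; rewrite !mxE -normCK exprn_ge0.
Qed.

Lemma qform_gt0 n (v : 'rV[C]_n) : v != 0 -> 0 < (v *m adj v) 0 0.
Proof.
move=> v0; rewrite lt_def qform_ge0 andbT; apply: contra v0.
rewrite mxE psumr_eq0 => [/allP h|i _]; last by rewrite !mxE -normCK exprn_ge0.
apply/eqP/rowP => i; rewrite !mxE; apply/eqP.
have := h i (mem_index_enum _).
by rewrite /= !mxE -normCK expf_eq0 /= normr_eq0.
Qed.

End Adjoint.

(** * Spectral calculus *)

Section Spectral.
Variables (R : realType) (n : nat).
Local Notation C := R[i].
Implicit Types (H U : 'M[C]_n) (v : 'rV[C]_n).

(** The real part mirrors the definition of [mxpow]. It loses nothing for Hermitian [H], whose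
    spectral diagonal is real. *)
Definition eigenval H (i : 'I_n) : R := complex.Re (spectral_diag H 0 i).

Lemma spectralV_adj H : adj (spectralmx H) *m spectralmx H = 1%:M.
Proof. exact/unitary_adjV/spectral_unitarymx. Qed.

Lemma spectral_adjV H : spectralmx H *m adj (spectralmx H) = 1%:M.
Proof. exact/unitaryV_adj/spectral_unitarymx. Qed.

Lemma mxpowE H t :
  mxpow H t = adj (spectralmx H) *m
    diag_mx (map_mx (real_complex R) (\row_i (eigenval H i `^ t))) *m
    spectralmx H.
Proof.
have <- : invmx (spectralmx H) = adj (spectralmx H).
  exact/unitary_adj/spectral_unitarymx.
rewrite /mxpow; congr (_ *m diag_mx _ *m _).
by apply/rowP=> i; rewrite !mxE.
Qed.

Lemma herm_spectral H : adj H = H ->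
  H = adj (spectralmx H) *m
    diag_mx (map_mx (real_complex R) (\row_i eigenval H i)) *m spectralmx H.
Proof.
move=> hH.
have SV : spectralmx H *m adj (spectralmx H) = 1%:M := spectral_adjV H.
have HN : H \is normalmx by apply/normalmxP; rewrite trmxC_adj hH.
have/orthomx_spectralP := HN.
rewrite unitary_adj; last exact: spectral_unitarymx.
rewrite /eigenval; move: (spectralmx H) (spectral_diag H) SV => S d SV eH.
have eD : diag_mx d = S *m H *m adj S.
  by rewrite [in RHS]eH !mulmxA SV mul1mx -mulmxA SV mulmx1.
(* The diagonal inherits Hermitian symmetry from [H], hence its entries are real. *)
have hD : adj (diag_mx d) = diag_mx d by rewrite eD !adjM adjK hH mulmxA.
rewrite {1}eH; congr (_ *m diag_mx _ *m _).
apply/rowP=> i; rewrite !mxE RRe_real//.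
apply/CrealP; have /matrixP/(_ i i) := hD.
by rewrite !mxE eqxx !mulr1n.
Qed.

Lemma mxpow_herm H t : adj (mxpow H t) = mxpow H t.
Proof. by rewrite mxpowE !adjM adjK adj_real_diag mulmxA. Qed.

(** [mxpow] uses the particular diagonalization picked by [spectralmx]. Its independence of that
    choice is what makes powers of explicit test matrices computable. *)
Lemma mxpow_unitary (d : 'rV[R]_n) U t : U \is unitarymx ->
  mxpow (adj U *m diag_mx (map_mx (real_complex R) d) *m U) t =
  adj U *m diag_mx (map_mx (real_complex R) (\row_i (d 0 i `^ t))) *m U.
Proof.
move=> uU; set H := adj U *m _ *m U.
have hH : adj H = H by rewrite /H !adjM adjK adj_real_diag mulmxA.
have eH := herm_spectral hH; rewrite mxpowE.
have VS : adj (spectralmx H) *m spectralmx H = 1%:M := spectralV_adj H.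
have SV : spectralmx H *m adj (spectralmx H) = 1%:M := spectral_adjV H.
move: (spectralmx H) (eigenval H) eH SV VS => S e eH SV VS.
have UV := unitaryV_adj uU; have VU := unitary_adjV uU.
(* [T] intertwines the two diagonal forms, hence also their powers. *)
set T := S *m adj U.
have tw : diag_mx (map_mx (real_complex R) (\row_i e i)) *m T =
          T *m diag_mx (map_mx (real_complex R) d).
  have : S *m H *m adj U = S *m H *m adj U by [].
  rewrite {1}eH /H !mulmxA SV mul1mx -!mulmxA UV mulmx1 => ->.
  by rewrite !mulmxA.
have twt : diag_mx (map_mx (real_complex R) (\row_i (e i `^ t))) *m T =
           T *m diag_mx (map_mx (real_complex R) (\row_i (d 0 i `^ t))).
  apply/matrixP=> i j; rewrite mul_diag_mx mul_mx_diag.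
  move/matrixP: tw => /(_ i j); rewrite mul_diag_mx mul_mx_diag.
  move: (T) => T'; rewrite !mxE.
  (* Entrywise, [e i * T i j = T i j * d j]. Where [T i j] is nonzero the two eigenvalues agree, and
     so do their powers. *)
  have [->|T0] := eqVneq (T' i j) 0; first by rewrite !mulr0 !mul0r.
  by rewrite mulrC => /(mulfI T0)/complexI ->; rewrite mulrC.
have -> : adj S = adj U *m adj T by rewrite /T adjM adjK mulmxA VU mul1mx.
have -> : S = T *m U by rewrite /T -mulmxA VU mulmx1.
rewrite !mulmxA; congr (_ *m _); rewrite -!mulmxA; congr (_ *m _).
rewrite twt mulmxA.
have -> : adj T *m T = 1%:M by rewrite /T adjM adjK mulmxA -[U *m _ *m _]mulmxA VS mulmx1.
by rewrite mul1mx.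
Qed.

Lemma mxpow_diag (d : 'rV[R]_n) t :
  mxpow (diag_mx (map_mx (real_complex R) d)) t =
  diag_mx (map_mx (real_complex R) (\row_i (d 0 i `^ t))).
Proof.
have u1 : (1%:M : 'M[C]_n) \is unitarymx.
  by apply/unitarymxP; rewrite trmx1 map_mx1 mulmx1.
have a1 : adj (1%:M : 'M[C]_n) = 1%:M by rewrite /adj map_mx1 trmx1.
by have := mxpow_unitary d t u1; rewrite a1 !mulmx1 !mul1mx.
Qed.

Lemma mxtrace_mxpow H t : \tr (mxpow H t) = (\sum_i (eigenval H i `^ t))%:C%C.
Proof.
rewrite mxpowE mxtrace_mulC mulmxA spectral_adjV mul1mx.
by rewrite mxtrace_diag rmorph_sum; apply: eq_bigr => i _; rewrite !mxE.
Qed.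

Lemma mxtrace_herm H : adj H = H -> \tr H = (\sum_i eigenval H i)%:C%C.
Proof.
move=> /herm_spectral {1}->.
rewrite mxtrace_mulC mulmxA spectral_adjV mul1mx.
by rewrite mxtrace_diag rmorph_sum; apply: eq_bigr => i _; rewrite !mxE.
Qed.

Lemma det_herm H : adj H = H -> \det H = (\prod_i eigenval H i)%:C%C.
Proof.
move=> /herm_spectral {1}->.
rewrite det_mulmx mulrC -det_mulmx mulmxA spectral_adjV.
by rewrite mul1mx det_diag rmorph_prod; apply: eq_bigr => i _; rewrite !mxE.
Qed.

Lemma qform_mxpow H t v : (v *m mxpow H t *m adj v) 0 0 =
  \sum_i (eigenval H i `^ t)%:C%C * `|(v *m adj (spectralmx H)) 0 i| ^+ 2.
Proof. by rewrite mxpowE qform_diag; apply: eq_bigr => i _; rewrite !mxE. Qed.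

Lemma qform_herm H v : adj H = H -> (v *m H *m adj v) 0 0 =
  \sum_i (eigenval H i)%:C%C * `|(v *m adj (spectralmx H)) 0 i| ^+ 2.
Proof.
move=> /herm_spectral {1}->.
by rewrite qform_diag; apply: eq_bigr => i _; rewrite !mxE.
Qed.

Definition psdef H := adj H = H /\ forall v, 0 <= (v *m H *m adj v) 0 0.

Lemma psdef_mxpow H t : psdef (mxpow H t).
Proof.
split=> [|v]; first exact: mxpow_herm.
rewrite qform_mxpow sumr_ge0// => i _.
by rewrite mulr_ge0 ?exprn_ge0// ler0c powR_ge0.
Qed.

Lemma psdef_congr H K : psdef H -> psdef (adj K *m H *m K).
Proof.
move=> [hH pH]; split=> [|v]; first by rewrite !adjM adjK hH mulmxA.
by have := pH (v *m adj K); rewrite adjM adjK !mulmxA.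
Qed.

(** Row [i] of the spectral matrix is a unit eigenvector, and the quadratic form there equals the
    eigenvalue. *)
Lemma eigenval_ge0 H i : psdef H -> 0 <= eigenval H i.
Proof.
move=> [hH pH]; set S := spectralmx H.
have := pH (row i S); rewrite qform_herm// -row_mul spectral_adjV.
rewrite (bigD1 i)//= big1 => [|j ji].
  by rewrite !mxE eqxx normr1 expr1n mulr1 addr0 ler0c.
by rewrite !mxE eq_sym (negPf ji) normr0 expr0n mulr0.
Qed.

Lemma mxpow_half_sqr H : psdef H -> mxpow H 2^-1 *m mxpow H 2^-1 = H.
Proof.
move=> pH; have [hH _] := pH; rewrite [RHS]herm_spectral// mxpowE.
rewrite !mulmxA -[_ *m spectralmx H *m adj _]mulmxA spectral_adjV.
rewrite mulmx1 -[adj _ *m _ *m diag_mx _]mulmxA mulmx_diag.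
congr (_ *m diag_mx _ *m _); apply/rowP=> i; rewrite !mxE.
rewrite -[RHS]/(real_complex R _) -rmorphM /= powR12_sqrt ?eigenval_ge0//.
by rewrite -expr2 sqr_sqrtr ?eigenval_ge0.
Qed.

(* Some eigenvalue of [H] is at least its Rayleigh quotient at [v]; the
   remaining summands of the trace are nonnegative since [powR] is. *)
Lemma mxtrace_mxpow_ge H v (g t : R) : adj H = H -> v != 0 -> 0 <= g -> 0 <= t ->
  g%:C%C * (v *m adj v) 0 0 <= (v *m H *m adj v) 0 0 ->
  (g `^ t)%:C%C <= \tr (mxpow H t).
Proof.
move=> hH v0 g0 t0; rewrite mxtrace_mxpow lecR.
have [/existsP[i gi] _|/existsPn lg] := boolP [exists i, g <= eigenval H i].
  rewrite (bigD1 i)//=.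
  apply: (@le_trans _ _ (eigenval H i `^ t)).
    by apply: ge0_ler_powR; rewrite // nnegrE// (le_trans g0).
  by rewrite lerDl sumr_ge0// => j _; exact: powR_ge0.
(* If every eigenvalue were below [g], the sum of [(g - lambda_i) |w_i|^2], with [w] the coordinates
   of [v] in the eigenbasis, would be positive. The Rayleigh bound makes it nonpositive. *)
rewrite qform_herm// => hle; exfalso.
set S := spectralmx H in hle.
have eN : (v *m adj v) 0 0 = \sum_i `|(v *m adj S) 0 i| ^+ 2.
  have -> : v *m adj v = v *m (adj S *m diag_mx (const_mx 1) *m S) *m adj v.
    by rewrite diag_const_mx mulmx1 spectralV_adj mulmx1.
  by rewrite qform_diag; apply: eq_bigr => i _; rewrite mxE mul1r.
have N0 := qform_gt0 v0.
have [i wi] : exists i, (v *m adj S) 0 i != 0.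
  apply/existsP; apply: contraT => /existsPn h.
  move: N0; rewrite eN big1 ?ltxx// => i _.
  by have := h i; rewrite negbK => /eqP ->; rewrite normr0 expr0n.
have : \sum_i (g%:C%C - (eigenval H i)%:C%C) * `|(v *m adj S) 0 i| ^+ 2 <= 0.
  rewrite (eq_bigr _ (fun i _ => mulrBl _ _ _)) sumrB -mulr_sumr -eN.
  by rewrite subr_le0.
apply/negP; rewrite lt_geF// (bigD1 i)//= ltr_wpDr//.
  rewrite sumr_ge0// => j _; rewrite mulr_ge0 ?exprn_ge0// subr_ge0 lecR.
  by have := lg j; rewrite -ltNge => /ltW.
rewrite mulr_gt0 ?exprn_gt0 ?normr_gt0// subr_gt0 ltcR.
by have := lg i; rewrite -ltNge.
Qed.

(* [l^t >= tau^(t-1) l] for every eigenvalue [l] in [[0, tau]]. *)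
Lemma qform_mxpow_ge H v (tau t : R) : psdef H -> 0 < t -> t <= 1 -> 0 < tau ->
  \tr H <= tau%:C%C ->
  (tau `^ (t - 1))%:C%C * (v *m H *m adj v) 0 0 <= (v *m mxpow H t *m adj v) 0 0.
Proof.
move=> pH t0 t1 tau0; have [hH _] := pH.
rewrite mxtrace_herm// lecR qform_herm// qform_mxpow mulr_sumr => trH.
apply: ler_sum => i _; rewrite mulrA ler_wpM2r ?exprn_ge0//.
rewrite -rmorphM /= lecR.
have l0 := eigenval_ge0 i pH.
have lt : eigenval H i <= tau.
  apply: le_trans trH; rewrite (bigD1 i)//= lerDl sumr_ge0// => j _.
  exact: eigenval_ge0.
(* For [l = 0] the left side vanishes. For [l > 0] a factor [l] cancels, and [l^(t-1)] is
   nonincreasing in [l] because [t <= 1]. *)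
move: l0 lt; move: (eigenval H i) => l; rewrite le_eqVlt => /predU1P[<- _|l0 lt].
  by rewrite mulr0 powR_ge0.
have -> : l `^ t = l `^ (t - 1) * l.
  by rewrite -{3}(powRr1 (ltW l0)) -powRD ?subrK// (gt_eqF l0) implybT.
rewrite ler_pM2r//.
have -> : t - 1 = - (1 - t) by rewrite opprB.
rewrite !powRN lef_pV2 ?posrE ?powR_gt0//.
by apply: ge0_ler_powR; rewrite ?nnegrE ?subr_ge0// ltW.
Qed.

End Spectral.

(** * Trace bounds *)

Section TraceBounds.
Variable R : realType.
Local Notation C := R[i].

Lemma qform_delta n (H : 'M[C]_n) i :
  ((delta_mx 0 i : 'rV[C]_n) *m H *m adj (delta_mx 0 i : 'rV[C]_n)) 0 0 = H i i.
Proof.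
have -> : adj (delta_mx 0 i : 'rV[C]_n) = delta_mx i 0.
  apply/matrixP=> k l; rewrite !mxE andbC; case: (_ && _).
    exact: rmorph1.
  exact: rmorph0.
by rewrite -rowE -colE !mxE.
Qed.

Lemma delta_mul_diag n (x : 'rV[R]_n) i : x 0 i = 1 ->
  (delta_mx 0 i : 'rV[C]_n) *m diag_mx (map_mx (real_complex R) x) = delta_mx 0 i.
Proof.
move=> xi; rewrite -rowE; apply/rowP=> j; rewrite !mxE.
have [_|_] := eqVneq j i; first by rewrite xi mulr1n.
by rewrite mulr0n.
Qed.

(** Since [x i0 = 1], the basis vector [e] at [i0] is fixed by every power of [X]. This reduces the
    entry of [G] at [i0] to a quadratic form of [M^alpha], and that of [M] to an entry of [Y]. *)
Lemma Ftilde_trace_ge n (alpha t y tau : R) (x : 'rV[R]_n) (Y : 'M[C]_n) i0 :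
  0 < alpha -> alpha <= 1 -> 0 <= t -> 0 < y -> 0 < tau ->
  (forall i, 0 < x 0 i) -> x 0 i0 = 1 -> psdef Y ->
  y%:C%C <= Y i0 i0 -> \sum_i (x 0 i)%:C%C * Y i i <= tau%:C%C ->
  ((y * tau `^ (alpha - 1)) `^ t)%:C%C <=
  \tr (mxpow (Ftilde alpha (diag_mx (map_mx (real_complex R) x)) Y) t).
Proof.
move=> al0 al1 t0 y0 tau0 x0 xi0 pY leY leT.
set X := diag_mx _.
have eI : invmx X = diag_mx (map_mx (real_complex R) (\row_i (x 0 i)^-1)).
  have uX : X \in unitmx.
    rewrite unitmxE unitfE det_diag; apply/prodf_neq0 => i _.
    by rewrite mxE gt_eqF// ltcR.
  have XI : X *m diag_mx (map_mx (real_complex R) (\row_i (x 0 i)^-1)) = 1%:M.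
    rewrite mulmx_diag -diag_const_mx; congr diag_mx; apply/rowP=> i.
    by rewrite !mxE -rmorphM /= divff// gt_eqF.
  by rewrite -[RHS]mul1mx -(mulVmx uX) -mulmxA XI mulmx1.
rewrite /Ftilde /gmean eI !mxpow_diag.
(* [D1] is [X^(-1/2)] and [D2] is [X^(1/2)], written as powers of [X^-1]. *)
set D1 := diag_mx (map_mx _ (\row__ (_ `^ 2^-1))).
set D2 := diag_mx (map_mx _ (\row__ (_ `^ (- 2^-1)))).
have hD1 : adj D1 = D1 by exact: adj_real_diag.
have hD2 : adj D2 = D2 by exact: adj_real_diag.
pose e : 'rV[C]_n := delta_mx 0 i0.
have eD1 : e *m D1 = e by apply: delta_mul_diag; rewrite !mxE xi0 invr1 powR1.
have eD2 : e *m D2 = e by apply: delta_mul_diag; rewrite !mxE xi0 invr1 powR1.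
set M := D2 *m Y *m D2.
have pM : psdef M by rewrite /M -{1}hD2; apply: psdef_congr.
have trM : \tr M <= tau%:C%C.
  apply: le_trans leT; rewrite /M mxtrace_mulC mulmxA mulmx_diag.
  apply: ler_sum => i _; rewrite mul_diag_mx !mxE -rmorphM /=.
  rewrite -powRD; last by rewrite invr_eq0 (gt_eqF (x0 i)) implybT.
  suff -> : (x 0 i)^-1 `^ (- 2^-1 - 2^-1) = x 0 i by [].
  have -> : - 2^-1 - 2^-1 = -1 :> R by lra.
  by rewrite powR_inv1 ?invrK// invr_ge0 ltW.
set G := D1 *m mxpow M alpha *m D1.
have pG : psdef G by rewrite /G -{1}hD1; apply: psdef_congr; exact: psdef_mxpow.
have [hG _] := pG.
have GM : G i0 i0 = (e *m mxpow M alpha *m adj e) 0 0.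
  rewrite -qform_delta -/e /G !mulmxA eD1 -[_ *m D1 *m _]mulmxA.
  by rewrite -{1}hD1 -adjM eD1.
have MY : (e *m M *m adj e) 0 0 = Y i0 i0.
  by rewrite -[RHS]qform_delta -/e /M !mulmxA eD2 -[_ *m D2 *m _]mulmxA
             -{1}hD2 -adjM eD2.
have GY : (y * tau `^ (alpha - 1))%:C%C <= G i0 i0.
  rewrite GM; apply: le_trans (qform_mxpow_ge e pM al0 al1 tau0 trM).
  by rewrite MY mulrC rmorphM /= ler_wpM2l// ler0c powR_ge0.
have yt0 : 0 < y * tau `^ (alpha - 1) by rewrite mulr_gt0// powR_gt0.
have G00 : 0 < G i0 i0 by apply: lt_le_trans GY; rewrite ltcR.
have GR : G i0 i0 = (complex.Re (G i0 i0))%:C%C by rewrite RRe_real// gtr0_real.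
set g := complex.Re _ in GR.
set Z := diag_mx (map_mx _ (\row__ (_ `^ (2 * _)))).
have KK := mxpow_half_sqr pG; have hK := mxpow_herm G 2^-1.
move: (mxpow G 2^-1) KK hK => K KK hK.
have hF : adj (K *m Z *m K) = K *m Z *m K by rewrite !adjM hK adj_real_diag mulmxA.
(* The test vector is [e K] with [K = G^(1/2)]. Its squared norm is [g], and the form of [K Z K]
   there is that of [Z] at row [i0] of [G]. *)
have wN : (e *m K *m adj (e *m K)) 0 0 = g%:C%C.
  by rewrite adjM hK !mulmxA -[e *m K *m K]mulmxA KK qform_delta.
have wF : ((e *m K) *m (K *m Z *m K) *m adj (e *m K)) 0 0 =
          \sum_j (x 0 j `^ (2 * (1 - alpha)))%:C%C * `|G i0 j| ^+ 2.
  have -> : e *m K *m (K *m Z *m K) *m adj (e *m K) = e *m G *m Z *m adj (e *m G).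
    by rewrite (adjM e K) (adjM e G) hK hG -KK !mulmxA.
  rewrite -rowE mxE; apply: eq_bigr => j _.
  by rewrite mul_mx_diag !mxE normCK mulrAC mulrC mulrA.
have g0 : 0 < g by rewrite -ltcR -GR.
apply: (@le_trans _ _ (g `^ t)%:C%C).
  rewrite lecR; apply: ge0_ler_powR => //; [exact: ltW|exact: ltW|].
  by rewrite -lecR -GR.
apply: (@mxtrace_mxpow_ge _ _ _ (e *m K)) => //; last 1 first.
(* Only the term [j = i0] is kept. Its weight is 1, so it equals [g^2] and the Rayleigh quotient is
   at least [g]. *)
- rewrite wN wF (bigD1 i0)// xi0 powR1 mul1r GR.
  have -> : `|g%:C%C| = g%:C%C by apply: ger0_norm; rewrite ler0c ltW.
  rewrite -expr2 lerDl sumr_ge0// => j _.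
  by rewrite mulr_ge0 ?exprn_ge0// ler0c powR_ge0.
- apply/eqP => w0; move: wN; rewrite w0 mul0mx mxE => /complexI g00.
  by rewrite -g00 ltxx in g0.
- exact: ltW.
Qed.

(** Trace and determinant fix the unordered pair of eigenvalues, so the trace of a power needs no
    explicit eigenvectors. *)
Lemma mxtrace_mxpow2 (H : 'M[C]_2) (t l1 l2 : R) : adj H = H ->
  \tr H = (l1 + l2)%:C%C -> \det H = (l1 * l2)%:C%C ->
  \tr (mxpow H t) = (l1 `^ t + l2 `^ t)%:C%C.
Proof.
move=> hH; rewrite mxtrace_herm// det_herm// mxtrace_mxpow.
rewrite !big_ord_recl !big_ord0 !addr0 !mulr1.
move: (eigenval H _) (eigenval H _) => a b /complexI eT /complexI eD.
have /eqP : (a - l1) * (a - l2) = 0.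
  transitivity (a * a - a * (l1 + l2) + l1 * l2); first by ring.
  by rewrite -eT -eD; ring.
rewrite mulf_eq0 !subr_eq0 => /orP[] /eqP ea; subst a.
  by rewrite addrC; have -> : b = l2 by lra.
by have -> : b = l1 by lra.
Qed.

Lemma posdef_diag n (d : 'rV[R]_n) : (forall i, 0 < d 0 i) ->
  posdef (diag_mx (map_mx (real_complex R) d)).
Proof.
move=> d0; split=> [|v v0]; first exact: adj_real_diag.
have [i vi] : exists i, v 0 i != 0.
  apply/existsP; apply: contraT => /existsPn h.
  suff v00 : v = 0 by rewrite v00 eqxx in v0.
  by apply/rowP=> i; rewrite mxE; have := h i; rewrite negbK => /eqP.
rewrite mxE (bigD1 i)//= mul_mx_diag !mxE mulrAC -normCK ltr_wpDr//.
  rewrite sumr_ge0// => j _; rewrite !mxE mulrAC -normCK.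
  by rewrite mulr_ge0 ?exprn_ge0// ler0c ltW.
by rewrite mulr_gt0 ?exprn_gt0 ?normr_gt0// ltcR.
Qed.

Lemma posdef_unitary n (H U : 'M[C]_n) : U \is unitarymx -> posdef H ->
  posdef (adj U *m H *m U).
Proof.
move=> uU [hH pH]; split=> [|v v0]; first by rewrite !adjM adjK hH mulmxA.
have := pH (v *m adj U); rewrite adjM adjK !mulmxA; apply.
apply: contra_neq v0 => vU.
by rewrite -[v]mulmx1 -(unitary_adjV uU) mulmxA vU mul0mx.
Qed.

End TraceBounds.

(** * The rotated pair *)

Section Rotation.
Variable R : realType.
Local Notation C := R[i].

(** Cosine and sine are arbitrary reals with [c^2 + s^2 = 1]. The matrices stay real until embedded
    by [map_mx], so that entrywise identities are left to [ring]. *)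
Definition rotmx (c s : R) : 'M[R]_2 :=
  \matrix_(i, j) (if i == j then c else if i == 0 then s else - s).

Definition diag2 (b : R) : 'rV[R]_2 := \row_i (if i == 0 then 1 else b).

Definition rotdiag (c s b : R) : 'M[R]_2 :=
  \matrix_(i, j) (if i == j then (if i == 0 then c ^+ 2 + b * s ^+ 2
                                  else s ^+ 2 + b * c ^+ 2)
                  else (1 - b) * (c * s)).

Lemma rotdiagE (c s b : R) :
  (rotmx c s)^T *m diag_mx (diag2 b) *m rotmx c s = rotdiag c s b.
Proof.
apply/matrixP=> i j; rewrite mxE !big_ord_recl big_ord0 mul_mx_diag !mxE.
by case: i j => [[|[|//]] ?] [[|[|//]] ?]; rewrite /= ; ring.
Qed.

Lemma rotmx_unitary (c s : R) : c ^+ 2 + s ^+ 2 = 1 ->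
  map_mx (real_complex R) (rotmx c s) \is unitarymx.
Proof.
move=> cs; apply/unitarymxP.
have -> : map_mx Num.conj (map_mx (real_complex R) (rotmx c s))^T =
          map_mx (real_complex R) (rotmx c s)^T.
  by apply/matrixP=> i j; rewrite !mxE; exact: conjc_real.
rewrite -map_mxM -(map_mx1 (real_complex R)); congr map_mx.
apply/matrixP=> i j; rewrite mxE !big_ord_recl big_ord0 !mxE.
by case: i j => [[|[|//]] ?] [[|[|//]] ?]; rewrite /= ?mulr1n ?mulr0n -?cs; ring.
Qed.

Lemma det_mx2 (A : 'M[R]_2) : \det A = A 0 0 * A 1 1 - A 0 1 * A 1 0.
Proof.
rewrite (expand_det_row A 0) !big_ord_recl big_ord0 addr0 /cofactor !det_mx11.
rewrite !mxE /= /bump /= expr0 expr1 mul1r mulN1r mulrN.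
by congr (A _ _ * A _ _ - A _ _ * A _ _); apply: val_inj.
Qed.

Lemma adj_map_real n (A : 'M[R]_n) :
  adj (map_mx (real_complex R) A) = map_mx (real_complex R) A^T.
Proof. by apply/matrixP=> i j; rewrite !mxE; exact: conjc_real. Qed.

Lemma diag2_powR (b t : R) : \row_i (diag2 b 0 i `^ t) = diag2 (b `^ t).
Proof. by apply/rowP=> i; rewrite !mxE; case: ifP => // _; rewrite powR1. Qed.

Lemma diag2_gt0 (b : R) i : 0 < b -> 0 < diag2 b 0 i.
Proof. by move=> b0; rewrite mxE; case: ifP. Qed.

Lemma powR_le1 (x t : R) : 0 <= x -> x <= 1 -> 0 <= t -> x `^ t <= 1.
Proof.
move=> x0 x1 t0; apply: (@le_trans _ _ (1 `^ t)); last by rewrite powR1.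
by apply: ge0_ler_powR; rewrite ?nnegrE.
Qed.

(** Each [q]-th power is [b^q] times the identity plus [1 - b^q] times a rank-one projection. The
    weighted sum of the two projections has trace 1 and determinant [alpha (1 - alpha) s^2], so its
    eigenvalues are [mu] and [1 - mu]; this gives the right-hand side. *)
Lemma rotated_pair_ineq (alpha p q c s b mu : R) :
  0 < alpha -> alpha < 1 -> 0 < p -> 0 < q ->
  (forall A B : 'M[C]_2, posdef A -> posdef B ->
     \tr (SGtilde alpha p A B) <= \tr (Amean alpha q A B)) ->
  c ^+ 2 + s ^+ 2 = 1 -> 0 < c ^+ 2 -> 0 < b -> b <= 1 ->
  alpha * (1 - alpha) * s ^+ 2 = mu * (1 - mu) ->
  (c ^+ 2 * (c ^+ 2 + 2 * b `^ p) `^ (alpha - 1)) `^ p^-1 <=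
  (b `^ q + (1 - b `^ q) * (1 - mu)) `^ q^-1 +
  (b `^ q + (1 - b `^ q) * mu) `^ q^-1.
Proof.
move=> al0 al1 p0 q0 H cs c0 b0 b1 hmu.
set U := map_mx (real_complex R) (rotmx c s).
have uU : U \is unitarymx := rotmx_unitary cs.
pose D e := diag_mx (map_mx (real_complex R) (diag2 e)).
have eN e : adj U *m D e *m U = map_mx (real_complex R) (rotdiag c s e).
  by rewrite /D /U adj_map_real -map_diag_mx -!map_mxM rotdiagE.
have pA : posdef (D b) by apply: posdef_diag => i; exact: diag2_gt0.
have pB := posdef_unitary uU pA.
have := H _ _ pA pB.
have powA t : mxpow (D b) t = D (b `^ t) by rewrite /D mxpow_diag diag2_powR.
have powB t : mxpow (adj U *m D b *m U) t = map_mx (real_complex R) (rotdiag c s (b `^ t)).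
  by rewrite -eN /D mxpow_unitary// diag2_powR.
have psB : psdef (map_mx (real_complex R) (rotdiag c s (b `^ p))).
  by rewrite -powB; exact: psdef_mxpow.
rewrite /SGtilde /Amean !powA !powB => {}H.
set W := _ + _ in H.
have eW : W = map_mx (real_complex R)
    ((1 - alpha) *: diag_mx (diag2 (b `^ q)) + alpha *: rotdiag c s (b `^ q)).
  by rewrite /W map_mxD !map_mxZ map_diag_mx.
have hW : adj W = W.
  rewrite eW adj_map_real; congr map_mx.
  apply/matrixP=> i j; rewrite !mxE.
  by case: i j => [[|[|//]] ?] [[|[|//]] ?].
rewrite -lecR; set rhs := (_ + _ `^ q^-1).
have <- : \tr (mxpow W q^-1) = rhs%:C%C.
  apply: mxtrace_mxpow2 => //; rewrite eW.
    rewrite trace_map_mx; congr (_ %:C)%C.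
    rewrite /mxtrace !big_ord_recl big_ord0 !mxE /= ?mulr1n.
    have -> : s ^+ 2 = 1 - c ^+ 2 by rewrite -cs; ring.
    by ring.
  rewrite det_map_mx; congr (_ %:C)%C; rewrite det_mx2 !mxE /= ?mulr1n ?mulr0n.
  set a := b `^ q.
  transitivity (a + (1 - a) ^+ 2 * (alpha * (1 - alpha) * s ^+ 2)); last by rewrite hmu; ring.
  have -> : c ^+ 2 = 1 - s ^+ 2 by rewrite -cs; ring.
  have -> : (1 - alpha) * 0 + alpha * ((1 - a) * (c * s)) = alpha * (1 - a) * (c * s) by ring.
  have -> : alpha * (1 - a) * (c * s) * (alpha * (1 - a) * (c * s)) =
    (alpha * (1 - a)) ^+ 2 * (c ^+ 2 * s ^+ 2) by ring.
  have -> : c ^+ 2 = 1 - s ^+ 2 by rewrite -cs; ring.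
  by ring.
apply: le_trans H.
have bp0 : 0 < b `^ p by exact: powR_gt0.
have bp1 : b `^ p <= 1.
  by apply: powR_le1 => //; exact: ltW.
have s0 : 0 <= s ^+ 2 by exact: sqr_ge0.
(* The corner of [B^p] is [c^2 + b^p s^2 >= c^2]. The weighted trace exceeds [c^2] by
   [b^p (2 s^2 + b^p c^2)], which is at most [2 b^p]. *)
apply: (@Ftilde_trace_ge R 2 alpha p^-1 (c ^+ 2) (c ^+ 2 + 2 * b `^ p) (diag2 (b `^ p)) _ 0) => //.
- exact: ltW.
- by rewrite invr_ge0 ltW.
- by nra.
- by move=> i; exact: diag2_gt0.
- by rewrite mxE.
- by rewrite !mxE /= lecR; nra.
rewrite !big_ord_recl big_ord0 addr0 !mxE /= -!rmorphM -!rmorphD /= lecR.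
have -> : s ^+ 2 = 1 - c ^+ 2 by rewrite -cs; ring.
by nra.
Qed.

End Rotation.

(** * Real estimates *)

Section Scalar.
Variable R : realType.

Lemma powR_invK (x t : R) : 0 <= x -> t != 0 -> (x `^ t^-1) `^ t = x.
Proof. by move=> x0 t0; rewrite -powRrM mulVf// powRr1. Qed.

Lemma ln_ge_1BV (y : R) : 0 < y -> 1 - y^-1 <= ln y.
Proof.
move=> y0; rewrite -[y in ln y]invrK lnV ?posrE ?invr_gt0// lerNr opprB.
have := @le_ln1Dx R (y^-1 - 1).
have -> : 1 + (y^-1 - 1) = y^-1 by ring.
by apply; rewrite ltrBrDr addrC subrr invr_gt0.
Qed.

(** Here [y] plays the role of [c^2] and [s] that of [b^p]. The bound follows from [exp u >= 1 + u]
    for the logarithm [u] of the right side, with [ln (y + 2 s) <= ln y + 2 s / y] and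
    [ln y >= 1 - 1 / y]. *)
Lemma wgeo_powR_ge (alpha p y s : R) : 0 < alpha -> alpha < 1 -> 0 < p -> 0 < y -> 0 < s ->
  1 - (alpha * (1 - y) + 2 * s) / (p * y) <=
  (y * (y + 2 * s) `^ (alpha - 1)) `^ p^-1.
Proof.
move=> al0 al1 p0 y0 s0.
have ys0 : 0 < y + 2 * s by lra.
have T0 : 0 < y * (y + 2 * s) `^ (alpha - 1) by rewrite mulr_gt0// powR_gt0.
rewrite [leRHS]/powR gt_eqF//; apply: le_trans (expR_ge1Dx _).
rewrite lerD2l lnM ?posrE ?powR_gt0// ln_powR.
have lys : ln (y + 2 * s) <= ln y + 2 * s / y.
  have -> : y + 2 * s = y * (1 + 2 * s / y) by field; rewrite gt_eqF.
  have sy0 : 0 < 2 * s / y by rewrite divr_gt0// mulr_gt0.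
  rewrite lnM ?posrE ?lerD2l//; last by lra.
  by apply: le_ln1Dx; lra.
have ly := ln_ge_1BV y0.
have -> : - ((alpha * (1 - y) + 2 * s) / (p * y)) =
  p^-1 * (alpha * (1 - y^-1) - 2 * s / y).
  by field; rewrite !gt_eqF.
have sy0 : 0 < 2 * s / y by rewrite divr_gt0// mulr_gt0.
rewrite ler_pM2l ?invr_gt0//.
move: ly lys sy0; set A := ln y; set B := ln _; set E := 2 * s / y; set F := y^-1.
by nra.
Qed.

(** With [r = 1 / q] and [a = b^q], the large eigenvalue supplies the first-order loss [r mu]. The
    small one is at most [2 mu], and its power is negligible against [mu] because [r > 1]. *)
Lemma interp_powR_le (r a mu eta : R) : 1 < r -> 0 < mu -> mu <= eta -> 0 < a -> a <= mu * eta ->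
  mu `^ (r - 1) <= eta -> eta <= 1 -> r * eta <= 1 ->
  (a + (1 - a) * (1 - mu)) `^ r + (a + (1 - a) * mu) `^ r <=
  1 - r * mu * (1 - eta) * (1 - r * eta) + 2 `^ r * eta * mu.
Proof.
move=> r1 mu0 mue a0 ae mur e1 re.
have r0 : 0 < r by lra.
have amu : a <= mu by nra.
apply: lerD.
  have -> : a + (1 - a) * (1 - mu) = 1 - mu + a * mu by ring.
  apply: (@le_trans _ _ (expR (- (mu - a)) `^ r)).
    apply: ge0_ler_powR; rewrite ?nnegrE ?expR_ge0 ?(ltW r0)//; first by nra.
    by apply: le_trans (expR_ge1Dx _); nra.
  rewrite -expRM mulNr expRN.
  set u := (mu - a) * r.
  have u0 : r * mu * (1 - eta) <= u by rewrite /u; nra.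
  have u00 : 0 <= u by rewrite /u mulr_ge0// ?subr_ge0// ltW.
  have ue : u <= r * eta by rewrite /u; nra.
  apply: (@le_trans _ _ (1 + u)^-1).
    by rewrite lef_pV2 ?posrE ?expR_gt0 ?expR_ge1Dx//; lra.
  (* After multiplication by [1 + u] this amounts to [u (1 - r eta) <= r eta], which follows from
     [u <= r eta]. *)
  apply: (@le_trans _ _ (1 - u * (1 - r * eta))).
    rewrite -[leLHS]mul1r ler_pdivrMr; last by lra.
    by nra.
  by rewrite lerD2l lerN2 ler_wpM2r// subr_ge0.
apply: (@le_trans _ _ ((2 * mu) `^ r)).
  by apply: ge0_ler_powR; rewrite ?nnegrE ?(ltW r0)//; nra.
rewrite powRM ?(ltW mu0)// -(mulr_powRB1 (ltW mu0) r0) -mulrA.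
by rewrite ler_pM2l ?powR_gt0// mulrC ler_pM2r.
Qed.

(** The limit is replaced by one point with explicit errors. Since [x] is close to [k mu], the
    hypothesis yields [r p <= alpha k] up to a multiple of [eta], whereas [q < (1 - alpha) p] means
    [alpha k < r p]. *)
Lemma exponent_bound (alpha p q : R) : 0 < alpha -> alpha < 1 -> 0 < p -> 0 < q -> q < 1 ->
  (forall x b mu : R, 0 <= x -> x < 1 -> 0 < b -> b <= 1 ->
    alpha * (1 - alpha) * x = mu * (1 - mu) ->
    ((1 - x) * (1 - x + 2 * b `^ p) `^ (alpha - 1)) `^ p^-1 <=
    (b `^ q + (1 - b `^ q) * (1 - mu)) `^ q^-1 +
    (b `^ q + (1 - b `^ q) * mu) `^ q^-1) ->
  (1 - alpha) * p <= q.
Proof.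
move=> al0 al1 p0 q0 q1 H; rewrite leNgt; apply/negP => qp.
set r := q^-1 in H.
have r1 : 1 < r by rewrite /r invf_gt1.
pose k := (alpha * (1 - alpha))^-1.
have aa0 : 0 < alpha * (1 - alpha) by rewrite mulr_gt0// subr_gt0.
have k0 : 0 < k by rewrite invr_gt0.
have ak : alpha * k < r * p.
  have -> : alpha * k = (1 - alpha)^-1.
    by rewrite /k; field; rewrite !gt_eqF// subr_gt0.
  rewrite -[ltLHS]mul1r ltr_pdivrMr ?subr_gt0//.
  by rewrite /r -mulrA mulrC ltr_pdivlMr// mul1r mulrC.
pose P2 := 2 `^ r : R.
have P20 : 0 < P2 by exact: powR_gt0.
pose K := r * p * (k + 1 + r) + 2 + P2 * p.
have rp0 : 0 < r * p by rewrite mulr_gt0//; lra.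
have K0 : 0 < K.
  by rewrite /K !addr_gt0// ?mulr_gt0//; lra.
(* [K] collects the first-order error terms, so that [eta * K] is below the
   gap [r * p - alpha * k]. *)
pose eta := Num.min ((r * p - alpha * k) / (2 * K)) (k + 1 + r)^-1.
have kr0 : 0 < k + 1 + r by lra.
have eta0 : 0 < eta by rewrite lt_min invr_gt0 kr0 divr_gt0 ?subr_gt0// mulr_gt0.
have etaK : eta * K < r * p - alpha * k.
  have : eta * (2 * K) <= r * p - alpha * k.
    by rewrite -ler_pdivlMr ?mulr_gt0// ge_min lexx.
  by have := mulr_gt0 eta0 K0; lra.
(* This single bound yields [r eta <= 1], [k eta < 1] and [eta <= 1]. *)
have etak : eta * (k + 1 + r) <= 1.
  by rewrite -ler_pdivlMr// mul1r ge_min lexx orbT.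
clearbody eta.
(* The second argument forces [mu^(r-1) <= eta]. *)
pose mu := Num.min eta (eta `^ (r - 1)^-1).
have mu0 : 0 < mu by rewrite lt_min eta0 powR_gt0.
have mue : mu <= eta by rewrite ge_min lexx.
have rB : 0 < r - 1 by rewrite subr_gt0.
have mur : mu `^ (r - 1) <= eta.
  rewrite -[leRHS](powR_invK (ltW eta0) (lt0r_neq0 rB)).
  by apply: ge0_ler_powR; rewrite ?nnegrE ?powR_ge0 ?ge_min ?lexx ?orbT ?ltW.
clearbody mu.
have re : r * eta <= 1 by nra.
have ke : k * eta < 1 by nra.
have e1 : eta <= 1 by nra.
have me0 : 0 < mu * eta by rewrite mulr_gt0.
(* The two arguments make [b^p] and [b^q] at most [mu eta], so that [b] only enters errors of order
   [mu eta]. *)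
pose b := Num.min ((mu * eta) `^ p^-1) ((mu * eta) `^ r).
have b0 : 0 < b by rewrite lt_min !powR_gt0.
have b1 : b <= 1.
  rewrite ge_min; apply/orP; left.
  by apply: powR_le1; rewrite ?invr_ge0 ?(ltW me0) ?(ltW p0)//; nra.
have bp : b `^ p <= mu * eta.
  rewrite -[leRHS](powR_invK (ltW me0) (lt0r_neq0 p0)).
  have lb : b <= (mu * eta) `^ p^-1 by rewrite ge_min lexx.
  by apply: ge0_ler_powR; rewrite ?nnegrE ?powR_ge0// ltW.
have bq : b `^ q <= mu * eta.
  rewrite -[leRHS](powR_invK (ltW me0) (lt0r_neq0 q0)) -/r.
  have lb : b <= (mu * eta) `^ r by rewrite ge_min lexx orbT.
  by apply: ge0_ler_powR; rewrite ?nnegrE ?powR_ge0// ltW.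
have bp0 : 0 < b `^ p by exact: powR_gt0.
have bq0 : 0 < b `^ q by exact: powR_gt0.
clearbody b.
pose x := k * (mu * (1 - mu)).
have mm0 : 0 <= mu * (1 - mu) by rewrite mulr_ge0 ?subr_ge0 ?(ltW mu0)// (le_trans mue).
have x0 : 0 <= x by rewrite /x mulr_ge0// ltW.
have xk : x <= k * mu by rewrite /x ler_pM2l//; nra.
have xk' : x <= k * eta by apply: le_trans xk _; rewrite ler_pM2l.
have x1 : x < 1 by lra.
have hx : alpha * (1 - alpha) * x = mu * (1 - mu).
  by rewrite /x /k mulrA divff ?mul1r// gt_eqF.
have {H} := H x b mu x0 x1 b0 b1 hx.
have y0 : 0 < 1 - x by rewrite subr_gt0.
clearbody x.
move/(le_trans (wgeo_powR_ge al0 al1 p0 y0 bp0))/le_trans.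
move/(_ _ (interp_powR_le r1 mu0 mue bq0 bq mur e1 re)).
rewrite -/P2; set Q := _ / _.
(* [Q] is the loss in the lower bound. Its denominator is bounded below using [x <= k eta], its
   numerator above using [x <= k mu]. *)
have QE : Q * (p * (1 - k * eta)) <= mu * (alpha * k + 2 * eta).
  apply: (@le_trans _ _ (Q * (p * (1 - x)))).
    rewrite ler_wpM2l//.
      apply: divr_ge0; last by apply: mulr_ge0; lra.
      by apply: addr_ge0; [apply: mulr_ge0; lra|lra].
    by rewrite ler_pM2l//; lra.
  rewrite /Q divfK; last by rewrite gt_eqF// mulr_gt0.
  have : alpha * x <= alpha * (k * mu) by rewrite ler_pM2l.
  by lra.
move: QE; clearbody Q => QE hle.
have hQ : mu * (r * (1 - eta) * (1 - r * eta) - P2 * eta) <= Q by lra.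
have pk0 : 0 <= p * (1 - k * eta) by rewrite mulr_ge0 ?(ltW p0)// subr_ge0 ltW.
have := le_trans (ler_wpM2r pk0 hQ) QE.
rewrite -[leLHS]mulrA ler_pM2l//.
(* The factor [mu] is gone. Linearizing the products in [eta] turns the inequality into
   [r p - alpha k <= eta K], against the choice of [eta]. *)
have h1 : 1 - (k + 1 + r) * eta <= (1 - k * eta) * ((1 - eta) * (1 - r * eta)).
  have : 1 - (1 + r) * eta <= (1 - eta) * (1 - r * eta) by nra.
  set Z := (1 - eta) * _ => hZ.
  have Z1 : Z <= 1 by rewrite /Z; nra.
  have : k * eta * Z <= k * eta by rewrite -[leRHS]mulr1; apply: ler_wpM2l => //; apply: mulr_ge0; exact: ltW.
  by lra.
have h2 : r * p * (1 - (k + 1 + r) * eta) <= r * p * ((1 - k * eta) * ((1 - eta) * (1 - r * eta))).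
  by rewrite ler_pM2l.
have h3 : P2 * eta * (p * (1 - k * eta)) <= P2 * eta * p.
  rewrite ler_pM2l ?mulr_gt0//.
  have : 0 <= p * (k * eta) by apply: mulr_ge0; [|apply: mulr_ge0]; exact: ltW.
  by lra.
move: etaK; rewrite /K.
by lra.
Qed.

End Scalar.

Theorem theorem4p37 (R : realType) (alpha p q : R) :
  0 < alpha -> alpha < 1 -> 0 < p -> 0 < q ->
  (forall A B : 'M[R[i]]_2, posdef A -> posdef B ->
     \tr (SGtilde alpha p A B) <= \tr (Amean alpha q A B)) ->
  Num.min 1 ((1 - alpha) * p) <= q.
Proof.
move=> al0 al1 p0 q0 H; rewrite ge_min.
have [//|q1] := leP 1 q; apply: exponent_bound => // x b mu x0 x1 b0 b1 hmu.
have y0 : 0 < 1 - x by rewrite subr_gt0.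
(* [x] is the squared sine of the rotation angle, so the cosine is the square root of [1 - x]. *)
rewrite -(sqr_sqrtr (ltW y0)).
apply: (rotated_pair_ineq (s := Num.sqrt x)) => //; rewrite ?sqr_sqrtr//.
- by rewrite subrK.
- exact: ltW.
- exact: ltW.
Qed.
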